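(* Let $G$ be a finitely generated sofic group, let $A$ be a finite alphabet (a finite set), let $M\subset G$ be finite, and let $S=A^{A^M}$. Suppose that $s\in S^G$ has uniformly bounded singularity and that $\sigma_s\colon A^G\to A^G$ is stably post-surjective. Then $\sigma_s$ is stably invertible.
   Context: Sofic group (standard notion): $G$ is sofic if for every finite $K\subset G$ and every $\varepsilon>0$ there exist $n\ge 1$ and a map $\varphi\colon G\to \mathrm{Sym}(n)$ with $d_H(\varphi(gh),\varphi(g)\varphi(h))\le\varepsilon$ for all $g,h\in K$ and $d_H(\varphi(g),\varphi(h))\ge 1-\varepsilon$ for all distinct $g,h\in K$, where $d_H$ is the normalized Hamming distance. For a set $B$, $B^G$ is the set of maps (configurations) $G\to B$, with the prodiscrete topology (product of discrete topologies) and the shift action $(gx)(h)=x(g^{-1}h)$ for $g,h\in G$, $x\in B^G$. For $x\in B^G$, $\Sigma(x)=\overline{\{gx: g\in G\}}\subset B^G$. Two configurations $x,y\in B^G$ are asymptotic if $x|_{G\setminus E}=y|_{G\setminus E}$ for some finite $E\subset G$. $S=A^{A^M}$ is the set of all maps $A^M\to A$. For $s\in S^G$, the non-uniform cellular automaton (NUCA) $\sigma_s\colon A^G\to A^G$ is defined by $\sigma_s(x)(g)=s(g)\big((g^{-1}x)|_M\big)$ for $x\in A^G$, $g\in G$. A configuration $s\in S^G$ has uniformly bounded singularity if for every finite $E\subset G$ with $1_G\in E=E^{-1}$ there is a finite $F\subset G$ containing $E$ such that the restriction $s|_{FE\setminus F}$ is constant. $\sigma_s$ is post-surjective if for all $x,y\in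 A^G$ with $y$ asymptotic to $\sigma_s(x)$, there is $z\in A^G$ asymptotic to $x$ with $\sigma_s(z)=y$. $\sigma_s$ is stably post-surjective if $\sigma_p$ is post-surjective for every $p\in\Sigma(s)\subset S^G$. $\sigma_s$ is stably invertible if there exist a finite set $N\subset G$ and $t\in T^G$, where $T=A^{A^N}$, such that for every $p\in\Sigma(s)$ there is some $q\in\Sigma(t)$ with $\sigma_p\circ\sigma_q=\sigma_q\circ\sigma_p=\mathrm{Id}$. *)

(* Defs.v *)
From HB Require Import structures.
From mathcomp Require Import all_boot all_order all_algebra all_fingroup finmap.
From mathcomp Require Import boolp classical_sets reals topology.

Set Implicit Arguments.
Unset Strict Implicit.
Unset Printing Implicit Defensive.

Local Open Scope classical_set_scope.
Local Open Scope group_scope.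

Definition finitely_generated (G : groupType) : Prop :=
  exists X : {fset G},
    smallest [set H : set G | group_closed [in H]] [set` X] = setT.

Definition hamming (R : realType) (n : nat) (u v : 'S_n) : R :=
  (#|[pred i | u i != v i]|%:R / n%:R)%R.

(* In MathComp (u * v) i = v (u i), so phi h * phi g is the permutation
   i |-> phi g (phi h i), the usual product of phi g and phi h in Sym(n). *)
Definition sofic (R : realType) (G : groupType) : Prop :=
  forall (K : {fset G}) (eps : R), (0 < eps)%R ->
  exists (n : nat) (phi : G -> 'S_n),
    [/\ (0 < n)%N,
        forall g h, g \in K -> h \in K ->
          (hamming R (phi (g * h)%g) (phi h * phi g)%g <= eps)%R
      & forall g h, g \in K -> h \in K -> g != h ->
          (1 - eps <= hamming R (phi g) (phi h))%R].

Section Configurations.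
Variables (G : groupType) (B : choiceType).
Implicit Types x y : G -> B.

Definition shift (g : G) x : G -> B := fun h => x (g^-1 * h).

(* {ptws G -> discrete_topology B} is G -> B with the prodiscrete topology. *)
Definition orbit_closure x : set (G -> B) :=
  closure (range (shift^~ x) : set {ptws G -> discrete_topology B}).

Definition asymptotic x y : Prop :=
  exists E : {fset G}, forall g, g \notin E -> x g = y g.

Definition uniformly_bounded_singularity x : Prop :=
  forall E : {fset G}, 1 \in E -> E = [fset e^-1 | e in E]%fset ->
  exists2 F : {fset G}, (E `<=` F)%fset &
    {in ([fset f * e | f in F, e in E] `\` F)%fset &, forall g h, x g = x h}.

End Configurations.

(* The set of all maps A^M -> A. *)
Definition local_rule (G : groupType) (M : {fset G}) (A : finType) :=
  {ffun {ffun M -> A} -> A}.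

Section NUCA.
Variables (G : groupType) (M : {fset G}) (A : finType).
Implicit Type s : G -> local_rule M A.

Definition restrict (x : G -> A) : {ffun M -> A} := [ffun m : M => x (val m)].

Definition nuca s (x : G -> A) : G -> A :=
  fun g => s g (restrict (shift g^-1 x)).

Definition post_surjective s : Prop :=
  forall x y : G -> A, asymptotic y (nuca s x) ->
  exists2 z : G -> A, asymptotic z x & nuca s z = y.

Definition stably_post_surjective s : Prop :=
  forall p, orbit_closure s p -> post_surjective p.

End NUCA.

Definition stably_invertible (G : groupType) (M : {fset G}) (A : finType)
    (s : G -> local_rule M A) : Prop :=
  exists (N : {fset G}) (t : G -> local_rule N A),
  forall p, orbit_closure s p ->
  exists2 q, orbit_closure t q &
    nuca p \o nuca q = id /\ nuca q \o nuca p = id.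

(* Main.v *)
Require Import Defs.
From mathcomp Require Import all_boot all_algebra finmap reals.
From mathcomp Require Import all_order all_fingroup zify.
From mathcomp Require Import mathcomp_extra boolp classical_sets filter topology.
Import Order.TTheory GRing.Theory Num.Theory.

(** The proof has two halves.

    Post-surjectivity of every [p] in the orbit closure of [s] is uniform: by
    compactness one finite set [E] serves all [p], all configurations and all
    prescribed values, in the sense that the value of the image at one cell [g]
    can be changed at will by altering the configuration inside [g E] only
    ([stably_post_surjective_uniform]).

    The first half shows that [s] is pre-injective ([sofic_pre_injective]).
    Suppose that two configurations [x1] and [x2] differ only on a finite set
    and have the same image.  Outside a large finite set [F], and up to a large
    distance from it, [s] is equal to a constant rule [c0].  A finite sofic
    approximation [V] of [G] behaves like [G] near most of its points.  Fill
    [V] with as many disjoint copies of [F] and its collar as possible, put a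
    copy of the rules of [s] on each copy of [F], and [c0] everywhere else.
    Every local pattern of this assignment of rules on [V] is a pattern of some
    [p] in the orbit closure of [s]: around a copy of [F] it is a pattern of
    [s] itself, and away from the copies it is constant, which [s] also
    exhibits in the collar if [G] is infinite (if [G] is finite, one may take
    [F] to be [G], and then maximality leaves no good point uncovered).  Hence
    cell-by-cell correction works on [V], and the induced map is onto, up to the
    few bad points ([model_surjective]).  On the other hand, the pattern of [x1]
    may be replaced by that of [x2] inside every copy of [F] without changing
    the image on good points, so the configurations on [V] that avoid [x1] in
    all copies have the same image as all configurations; each copy costs a
    fixed factor less than [1], and the number of copies is proportional to the
    size of [V] ([card_avoiding]).  With few enough bad points these two
    facts contradict each other.

    The second half makes an inverse.  Pre-injectivity passes to the orbit
    closure.  Together with the set [E] it shows that the value of a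
    configuration at [g] is determined by its image on [g N], where [N]
    consists of [1] and of the inverses of the elements of [E]
    ([locally_determined]): a correction of the image at a cell outside [g N]
    does not touch [g].  Reading off this value is a rule on [N] that depends
    only on [p] near [g] and commutes with translations, so it sends the orbit
    closure of [s] into that of a single [t]. *)

Set Implicit Arguments.
Unset Strict Implicit.
Unset Printing Implicit Defensive.

Local Open Scope classical_set_scope.
Local Open Scope group_scope.

(** * Orbit closures and compactness *)

Section Closure.
Variables (G : groupType) (B : choiceType).
Implicit Types (x p : G -> B) (K : {fset G}).

Lemma orbit_closureP x p :
  orbit_closure x p <-> forall K, exists g, {in K, p =1 shift g x}.
Proof.
split=> [clp K|apx].
  have nbK : @nbhs _ {ptws G -> discrete_topology B} p
      (\bigcap_(k in [set` K]) (proj k @^-1` [set p k])).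
    have Fp := nbhs_filter (p : {ptws G -> discrete_topology B}).
    apply: filter_bigI => k _.
    apply: (@proj_continuous G (fun=> discrete_topology B) k p).
    by rewrite nbhs_principalE; apply/principal_filterP.
  have [_ [[g _ <-] gK]] := clp _ nbK.
  by exists g => k kK; rewrite -(gK k kK).
pose cyl K := [set q : G -> B | {in K, p =1 q}].
have Fcyl : Filter (filter_from setT cyl).
  apply: filter_from_filter => [|K L _ _]; first by exists fset0.
  exists (K `|` L)%fset => // q pq.
  by split=> k kK; apply: pq; rewrite inE kK ?orbT.
have cvp : filter_from setT cyl --> (p : {ptws G -> discrete_topology B}).
  apply/cvg_sup => k U [_ [[W oW <-] Wp WU]].
  exists [fset k]%fset => // q pq; apply: WU => /=.
  by rewrite /proj -pq ?inE.
move=> U /cvp [K _ KU]; have [g gK] := apx K.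
by exists (shift g x); split; [exists g | apply: KU].
Qed.

End Closure.

Lemma ultra_finite_partition (I : Type) (C : finType) (U : set_system I)
    (f : I -> C) : UltraFilter U -> exists c, U [set i | f i = c].
Proof.
move=> UU; apply: contrapT => /forallNP noc.
have Uc c : U [set i | f i <> c].
  by case: (in_ultra_setVsetC [set i | f i = c] UU) => // /noc.
have : U (\bigcap_(c in [set` [fset c in C]%fset]) [set i | f i <> c]).
  by apply: filter_bigI.
by case/filter_ex => i /(_ (f i)); apply=> //=; rewrite !inE.
Qed.

(** Compactness of the product of finite discrete spaces, for nets indexed by
    finite subsets of [G]: the limit is taken coordinatewise along an
    ultrafilter that contains all the sets of supersets of a given one. *)
Lemma configuration_cluster (G : groupType) (C : finType)
    (f : {fset G} -> G -> C) :
  exists x : G -> C, forall K E : {fset G},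
    exists2 E', (E `<=` E')%fset & {in K, f E' =1 x}.
Proof.
pose up (E : {fset G}) := [set E' : {fset G} | (E `<=` E')%fset].
have Pup : ProperFilter (filter_from setT up).
  apply: filter_from_proper; last by move=> E _; exists E; rewrite /up /=.
  apply: filter_from_filter => [|E F _ _]; first by exists fset0.
  exists (E `|` F)%fset => // E'; rewrite /up /= fsubUset.
  by case/andP.
have [U [UU upU]] := ultraFilterLemma Pup.
have /choice [x Ux] g : exists c, U [set E | f E g = c].
  exact: ultra_finite_partition.
exists x => K E.
have UK : U (\bigcap_(k in [set` K]) [set E | f E k = x k]).
  by apply: filter_bigI => k _.
have UE : U (up E) by apply: upU; exists E.
have UKE := filterI UK UE; have [E' [E'K EE']] := filter_ex (UKE _).
by exists E'.
Qed.

(** * Finite products, translates and local rules *)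

Section FiniteProducts.
Variable G : groupType.
Implicit Types E F K : {fset G}.

Definition mulfs E F : {fset G} := [fset e * f | e in E, f in F]%fset.
Definition invfs E : {fset G} := [fset e^-1 | e in E]%fset.

Lemma mem_mulfs E F e f : e \in E -> f \in F -> e * f \in mulfs E F.
Proof. exact: in_imfset2. Qed.

Lemma mulfsP E F g :
  reflect (exists2 e, e \in E & exists2 f, f \in F & g = e * f)
          (g \in mulfs E F).
Proof. exact: imfset2P. Qed.

Lemma mem_invfs E g : (g \in invfs E) = (g^-1 \in E).
Proof.
apply/imfsetP/idP => [[e eE ->]|gE]; first by rewrite invgK.
by exists g^-1; rewrite ?invgK.
Qed.

End FiniteProducts.

Section Translates.
Variables (G : groupType) (B : choiceType).
Implicit Types x p : G -> B.

Lemma shiftK g x : shift g (shift g^-1 x) = x.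
Proof. by apply/funext => h; rewrite /shift invgK mulKVg. Qed.

Lemma orbit_closure_self x : orbit_closure x x.
Proof.
by apply/orbit_closureP => K; exists 1 => k _; rewrite /shift invg1 mul1g.
Qed.

Lemma orbit_closure_shift g x p :
  orbit_closure x p -> orbit_closure x (shift g p).
Proof.
move/orbit_closureP => xp; apply/orbit_closureP => K.
have [h hK] := xp (mulfs [fset g^-1]%fset K).
exists (g * h) => k kK; rewrite /shift hK ?mem_mulfs ?inE //.
by rewrite /shift invgM mulgA.
Qed.

End Translates.

Section LocalRules.
Variables (G : groupType) (M : {fset G}) (A : finType).
Implicit Types (s p : G -> local_rule M A) (x y z : G -> A) (E : {fset G}).

Definition window x g : {ffun M -> A} := [ffun m : M => x (g * val m)].

Lemma nucaE s x g : nuca s x g = s g (window x g).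
Proof.
by congr (s g _); apply/ffunP => m; rewrite !ffunE /shift invgK.
Qed.

Lemma eq_nuca s p x y g :
  s g = p g -> {in M, forall m, x (g * m) = y (g * m)} ->
  nuca s x g = nuca p y g.
Proof.
move=> spg xyg; rewrite !nucaE spg; congr (p g _).
by apply/ffunP => m; rewrite !ffunE xyg ?fsvalP.
Qed.

Lemma nuca_shift s x g h : nuca (shift g s) (shift g x) h = nuca s x (g^-1 * h).
Proof.
rewrite !nucaE; congr (s _ _); apply/ffunP => m.
by rewrite !ffunE /shift mulgA.
Qed.

Definition pre_injective s :=
  forall x1 x2, asymptotic x1 x2 -> nuca s x1 = nuca s x2 -> x1 = x2.

Definition uniformly_post_surjective s E :=
  forall p, orbit_closure s p -> forall x a, exists z,
    [/\ forall g, g \notin E -> z g = x g, nuca p z 1 = a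
      & forall g, g != 1 -> nuca p z g = nuca p x g].

(** If no finite set [E] were good enough, there would be for each [E] a
    counterexample made of a rule [p], a configuration [x] and a value [a].  A
    cluster point of these triples is corrected on some finite set [Ez]; the
    same correction works for every triple that agrees with the limit near
    [Ez], in particular for one that was a counterexample to a set
    containing [Ez]. *)
Lemma stably_post_surjective_uniform s :
  stably_post_surjective s -> exists E, uniformly_post_surjective s E.
Proof.
move=> sps; apply: contrapT => /forallNP noE.
have bad E : exists pxa : (G -> local_rule M A) * (G -> A) * A,
    orbit_closure s pxa.1.1 /\
    ~ exists z, [/\ forall g, g \notin E -> z g = pxa.1.2 g,
      nuca pxa.1.1 z 1 = pxa.2
      & forall g, g != 1 -> nuca pxa.1.1 z g = nuca pxa.1.1 pxa.1.2 g].
  have /existsNP [p /not_implyP [sp /existsNP[x /existsNP[a nz]]]] := noE E.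
  by exists (p, x, a).
have {}/choice [w wbad] := bad.
have [l lw] := configuration_cluster
  (fun E g => ((w E).1.1 g, (w E).1.2 g, (w E).2) : local_rule M A * A * A).
pose p g := (l g).1.1; pose x g := (l g).1.2; pose a := (l 1).2.
have sp : orbit_closure s p.
  apply/orbit_closureP => K; have [E _ EK] := lw K fset0.
  have /orbit_closureP/(_ K) [g gK] := (wbad E).1.
  by exists g => k kK; rewrite -gK // /p -EK.
pose y g := if g == 1 then a else nuca p x g.
have yx : asymptotic y (nuca p x).
  by exists [fset 1]%fset => g; rewrite inE /y => /negPf ->.
have [z [Ez zx] pz] := sps p sp x y yx.
pose H := (1 |` mulfs Ez (invfs M))%fset.
have [E EzE EK] := lw (H `|` mulfs H M)%fset Ez.
case: (wbad E) => _; apply; set p' := (w E).1.1; set x' := (w E).1.2.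
have p'p : {in H, p' =1 p}.
  by move=> g gH; rewrite /p -EK // inE gH.
have x'x : {in mulfs H M, x' =1 x}.
  by move=> g gH; rewrite /x -EK // inE gH orbT.
have aE : (w E).2 = a by rewrite /a -EK // !inE eqxx.
pose z' g := if g \in Ez then z g else x' g.
have nearH g : g \in H -> nuca p' z' g = y g /\ nuca p' x' g = nuca p x g.
  move=> gH; split; last first.
    by apply: eq_nuca => [|m mM]; [exact: p'p | rewrite x'x ?mem_mulfs].
  rewrite -pz; apply: eq_nuca => [|m mM]; first exact: p'p.
  by rewrite /z'; case: ifPn => // gE; rewrite x'x ?mem_mulfs // zx.
exists z'; split.
- move=> g gE; rewrite /z' ifN //; apply: contra gE.
  exact: (fsubsetP EzE).
- by have [-> _] := nearH 1 (fset1U1 _ _); rewrite aE /y eqxx.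
- move=> g g1; have [gH|gH] := boolP (g \in H).
    by have [-> ->] := nearH g gH; rewrite /y ifN.
  apply: eq_nuca => // m mM; rewrite /z' ifN //.
  apply: contra gH => gmE; rewrite inE; apply/orP; right.
  by apply/mulfsP; exists (g * m) => //; exists m^-1; rewrite ?mem_invfs ?invgK ?mulgK.
Qed.

End LocalRules.

(** * Sofic groups act on finite sets, up to few exceptions *)

(** [act] is any map, written as a right action; at a point [v] with a chart
    on [K] it looks like right multiplication of [G] on [K].  Equations at [v]
    alone suffice, because the points near [v] are always written [act v g]. *)
Definition chart (G : groupType) (V : finType) (act : V -> G -> V)
    (K : {fset G}) (v : V) : Prop :=
  [/\ act v 1 = v,
      {in K &, forall g h, act (act v g) h = act v (g * h)}
    & {in K &, injective (act v)}].

Lemma card_bigcup_seq_le (V : finType) (I : eqType) (r : seq I)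
    (F : I -> {set V}) (k m : nat) :
  {in r, forall i, (#|F i| * k <= m)%N} ->
  (#|\bigcup_(i <- r) F i|%SET * k <= size r * m)%N.
Proof.
elim: r => [_|i r IH Fr]; first by rewrite big_nil cards0.
rewrite big_cons /= mulSn.
apply: (@leq_trans ((#|F i| + #|\bigcup_(j <- r) F j|%SET) * k)).
  by rewrite leq_mul2r cardsU leq_subr orbT.
rewrite mulnDl leq_add ?Fr ?mem_head ?IH // => j jr.
by apply: Fr; rewrite inE jr orbT.
Qed.

Section Hamming.
Variables (R : realType) (n k : nat) (u v : 'S_n).
Hypotheses (n_gt0 : (0 < n)%N) (k_gt0 : (0 < k)%N).

Lemma hamming_le_invn :
  (hamming R u v <= k%:R^-1)%R -> (#|[set i | u i != v i]%SET| * k <= n)%N.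
Proof.
rewrite /hamming cardsE ler_pdivrMr ?ltr0n // mulrC ler_pdivlMr ?ltr0n //.
by rewrite -natrM ler_nat.
Qed.

Lemma hamming_ge_subr_invn :
  (1 - k%:R^-1 <= hamming R u v)%R ->
  (#|[set i | u i == v i]%SET| * k <= n)%N.
Proof.
rewrite /hamming lerBlDr -lerBlDl => le1.
have := cardsC [set i | u i == v i]%SET; rewrite card_ord => cardn.
have -> : #|[set i | u i == v i]%SET| = (n - #|[pred i | u i != v i]|)%N.
  apply/eqP; rewrite -(eqn_add2r #|[pred i | u i != v i]|) subnK.
    rewrite -[X in _ == X]cardn eqn_add2l; apply/eqP/eq_card => i.
    by rewrite !inE.
  by rewrite -[X in (_ <= X)%N]card_ord max_card.
have le : (#|[pred i | u i != v i]| <= n)%N.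
  by rewrite -[X in (_ <= X)%N]card_ord max_card.
rewrite -(ler_nat R) natrM natrB // -ler_pdivlMr ?ltr0n //.
rewrite mulrC -ler_pdivrMr ?ltr0n // mulrBl divff ?pnatr_eq0 -?lt0n //.
Qed.
End Hamming.

(** Inverting the group element turns the left action of permutations into a
    right action.  The bad points are the points where one of finitely many
    equations or disequations fails, and each of these fails on a proportion at
    most [1 / k] of the points. *)
Lemma sofic_charts (R : realType) (G : groupType) (K : {fset G}) (T : nat) :
  sofic R G ->
  exists (n : nat) (act : 'I_n -> G -> 'I_n) (W : {set 'I_n}),
    [/\ (0 < n)%N, (#|~: W|%SET * T <= n)%N
      & forall w, w \in W -> chart act K w].
Proof.
move=> soficG; pose K1 := invfs (1 |` K)%fset.
have K1_gt0 : (0 < #|`K1|)%N.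
  by rewrite cardfs_gt0; apply/fset0Pn; exists 1; rewrite mem_invfs invg1 fset1U1.
pose k := (#|`K1| * #|`K1| * 2 * T.+1)%N.
have k_gt0 : (0 < k)%N by rewrite !muln_gt0 K1_gt0.
have [|n [phi [n_gt0 phiM phiI]]] := soficG K1 k%:R^-1%R.
  by rewrite invr_gt0 ltr0n.
pose bad g h : {set 'I_n} := ([set v | phi (g * h) v != (phi h * phi g) v] :|:
                 [set v | (g != h) && (phi g v == phi h v)])%SET.
pose W : {set 'I_n} := (~: \bigcup_(g <- K1) \bigcup_(h <- K1) bad g h)%SET.
exists n, (fun v g => phi g^-1 v), W; split=> //.
  have badk g h : g \in K1 -> h \in K1 -> (#|bad g h| * k <= 2 * n)%N.
    move=> gK hK.
    apply: leq_trans (leq_mul (leq_card_setU _ _) (leqnn k)) _.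
    rewrite mulnDl mul2n -addnn leq_add //.
      by apply: (@hamming_le_invn R) => //; apply: phiM.
    have [->|gh] := eqVneq g h.
      by rewrite eq_card0 // => v; rewrite !inE.
    by apply: (@hamming_ge_subr_invn R) => //; apply: phiI.
  have badK1 : (#|~: W|%SET * k <= #|`K1| * (#|`K1| * (2 * n)))%N.
    rewrite /W finset.setCK; apply: card_bigcup_seq_le => g gK.
    by apply: card_bigcup_seq_le => h hK; apply: badk.
  rewrite -(@leq_pmul2l (#|`K1| * #|`K1| * 2)) ?muln_gt0 ?K1_gt0 //.
  rewrite -!mulnA; apply: leq_trans badK1.
  rewrite !(mulnCA #|~: W|%SET) /k -!mulnA.
  by rewrite !leq_mul2l leqnSn !orbT.
move=> w wW.
have good g h : g \in K1 -> h \in K1 -> w \notin bad g h.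
  move=> gK hK; apply: contraTN wW => wbad; rewrite /W inE negbK.
  by rewrite (big_rem g) //= inE (big_rem h) //= inE wbad.
have KV g : g \in K -> g^-1 \in K1 by rewrite mem_invfs invgK => /fset1Ur ->.
have K11 : 1 \in K1 by rewrite mem_invfs invg1 fset1U1.
have mul g h : g \in K1 -> h \in K1 -> phi (g * h) w = phi g (phi h w).
  move=> gK hK; have := good g h gK hK; rewrite !inE negb_or negbK.
  by case/andP => /eqP-> _; rewrite permM.
split.
(* The equation for 1 * 1 gives phi 1 (phi 1 w) = phi 1 w. *)
- apply: (@perm_inj _ (phi 1)).
  by rewrite invg1 -mul // mulg1.
- by move=> g h gK hK; rewrite -mul ?KV // invgM.
move=> g h gK hK /= eqw; apply/eqP; apply: contraT => gh.
have := good g^-1 h^-1 (KV _ gK) (KV _ hK); rewrite !inE negb_or eqw eqxx andbT.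
by rewrite (inj_eq invg_inj) gh andbF.
Qed.

(** * Constant collars *)

Section Growth.
Variable G : groupType.
Implicit Types (E F H X : {fset G}) (g h : G).

(** Generation expressed through sets stable by right multiplication, which is
    how it is used: such a nonempty set is everything. *)
Definition generating X :=
  forall P : set G, P !=set0 ->
    (forall g x, P g -> x \in X -> P (g * x)) -> forall g, P g.

Lemma finitely_generated_generating :
  finitely_generated G -> exists2 X, 1 \in X & generating X.
Proof.
move=> [Y genY]; exists (1 |` Y `|` invfs Y)%fset; first by rewrite !inE eqxx.
move=> P [p Pp] PX.
pose stab : set G := [set h | forall g, P (g * h) <-> P g].
have stabT : stab = setT.
  apply/seteqP; split=> // h _.
  have : smallest [set H : set G | group_closed [in H]] [set` Y] h.
    by rewrite genY.
  apply; split.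
    split=> [|a b /set_mem sa /set_mem sb]; apply/mem_set => g.
      by rewrite mulg1.
    by rewrite mulgA -(sb (g * a * b^-1)) mulgVK sa.
  move=> y Yy g; split=> [Pgy|Pg]; last by apply: PX; rewrite // !inE Yy orbT.
  by rewrite -(mulgK y g); apply: PX; rewrite // !inE mem_invfs invgK Yy orbT.
move=> g; have : stab (p^-1 * g) by rewrite stabT.
by move/(_ p); rewrite mulKVg => ->.
Qed.

Fixpoint power X r : {fset G} :=
  if r is r'.+1 then mulfs (power X r') X else [fset 1]%fset.

Lemma sub_power X H :
  1 \in X -> generating X -> exists r, (H `<=` power X r)%fset.
Proof.
move=> X1 genX.
have mono r r' : (r <= r')%N -> (power X r `<=` power X r')%fset.
  move/subnK <-; elim: (r' - r)%N => // k IH.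
  apply: fsubset_trans IH _; apply/fsubsetP => g gk.
  by apply/mulfsP; exists g => //; exists 1; rewrite ?mulg1.
have /choice [rad radP] h : exists r, h \in power X r.
  apply: (genX [set g | exists r, g \in power X r]).
    by exists 1; exists 0%N; rewrite inE.
  by move=> g x [r gr] xX; exists r.+1; apply: mem_mulfs.
exists (\max_(h <- H) rad h); apply/fsubsetP => h hH.
by apply: (fsubsetP (mono (rad h) _ _)); rewrite ?radP ?leq_bigmax_seq.
Qed.

(** The constant value [c] of the collar must itself occur in [s] on a
    translate of the prescribed set [H].  In an infinite group generated by a
    finite set [X], the sets [F X^r] keep growing, so some [g] lies in
    [F X^(r+1)] but not in [F X^r]; if [X^r] contains the inverses of [H] then
    [g H] misses [F], and it lies in the collar as soon as the latter is thick
    enough.  If the growth stops, then [G] is finite. *)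
Lemma constant_collar (B : choiceType) (s : G -> B) E H :
  finitely_generated G -> uniformly_bounded_singularity s ->
  exists F c,
    [/\ (E `<=` F)%fset, {in mulfs F E, forall g, g \notin F -> s g = c}
      & (exists g, {in H, forall h, s (g * h) = c}) \/ forall g, g \in F].
Proof.
move=> /finitely_generated_generating[X X1 genX] ubs.
have [r Hr] := sub_power (invfs H) X1 genX.
pose E1 := (1 |` E `|` mulfs (power X r.+1) H)%fset.
pose E2 := (E1 `|` invfs E1)%fset.
have [||F EF sF] := ubs E2.
- by rewrite !inE eqxx.
- apply/fsetP => g; rewrite -/(invfs _) mem_invfs /E2.
  by rewrite ![_ \in (E1 `|` _)%fset]in_fsetU !mem_invfs invgK orbC.
have sub12 : (E1 `<=` E2)%fset by apply: fsubsetUl.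
have [full|] := pselect (forall g x, g \in mulfs F (power X r) -> x \in X ->
    g * x \in mulfs F (power X r)).
  have all : forall g, g \in mulfs F (power X r).
    apply: (genX [set g | g \in mulfs F (power X r)]) => //.
    exists (1 * 1); apply: mem_mulfs.
      by apply: (fsubsetP EF); rewrite !inE eqxx.
    by elim: r {Hr E1 E2 EF sF sub12 full} => [|r IH]; rewrite ?inE // -(mulg1 1) mem_mulfs.
  exists (mulfs F (power X r)), (s 1); split; last by right.
    by apply/fsubsetP.
  by move=> g _; rewrite all.
move=> /existsNP[g0 /existsNP[x /not_implyP[g0F /not_implyP[xX /negP gF]]]].
set g := g0 * x in gF.
have collar h : h \in H -> g * h \in (mulfs F E2 `\` F)%fset.
  move=> hH; rewrite in_fsetD; apply/andP; split.
    apply: contra gF => ghF; apply/mulfsP; exists (g * h) => //.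
    exists h^-1; last by rewrite mulgK.
    by apply: (fsubsetP Hr); rewrite mem_invfs invgK.
  have /mulfsP[f fF [b br gE]] := g0F.
  apply/mulfsP; exists f => //; exists (b * x * h); last by rewrite /g gE !mulgA.
  apply: (fsubsetP sub12); rewrite inE; apply/orP; right.
  by rewrite !mem_mulfs.
have [c sc] : exists c, {in (mulfs F E2 `\` F)%fset, forall g, s g = c}.
  have [->|/fset0Pn [k kF]] := eqVneq (mulfs F E2 `\` F)%fset fset0.
    by exists (s 1) => ?; rewrite inE.
  by exists (s k) => l lF; apply: sF.
have sE2 : (E `<=` E2)%fset.
  by apply: fsubset_trans sub12; apply/fsubsetP => e eE; rewrite !inE eE orbT.
exists F, c; split.
- exact: fsubset_trans EF.
- move=> k /mulfsP[f fF [e eE ->]] kF; apply: sc; rewrite in_fsetD kF mem_mulfs //.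
  exact: (fsubsetP sE2).
by left; exists g => h hH; apply: sc; apply: collar.
Qed.

End Growth.

(** * Finite models *)

Section FiniteModel.
Variables (G : groupType) (M : {fset G}) (A : finType).
Variables (V : finType) (act : V -> G -> V) (K : {fset G}).
Variable rule : V -> local_rule M A.
Implicit Types (u : {ffun V -> A}) (p s : G -> local_rule M A) (x z : G -> A).
Implicit Types (v w c : V) (D E : {fset G}).

Definition model u v : A := rule v [ffun m : M => u (act v (val m))].

(** Transport of [z] from [D] to [V] through [act c], on top of [u]; in a chart
    the picked [d] is unique, which makes the formula meaningful. *)
Definition implant u c D z : {ffun V -> A} :=
  [ffun v => if [pick d : D | act c (val d) == v] is Some d then z (val d)
             else u v].

Lemma implant_in u c D z k :
  chart act K c -> (D `<=` K)%fset -> k \in K ->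
  (k \notin D -> z k = u (act c k)) -> implant u c D z (act c k) = z k.
Proof.
move=> [_ _ cI] /fsubsetP DK kK zk; rewrite ffunE; case: pickP => [d /eqP ck|nod].
  by rewrite (cI _ _ _ _ ck) // DK // fsvalP.
rewrite zk //; apply/negP => kD.
by have := nod [` kD]%fset; rewrite /= eqxx.
Qed.

Lemma implant_out u c D z v :
  {in D, forall d, act c d != v} -> implant u c D z v = u v.
Proof.
by move=> nov; rewrite ffunE; case: pickP => // d; rewrite (negPf (nov _ (fsvalP d))).
Qed.

Lemma model_chart u c p x h :
  chart act K c -> h \in K -> (M `<=` K)%fset -> rule (act c h) = p h ->
  {in M, forall m, u (act c (h * m)) = x (h * m)} ->
  model u (act c h) = nuca p x h.
Proof.
move=> [_ cM _] hK /fsubsetP MK rp ux; rewrite nucaE /model rp; congr (p h _).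
apply/ffunP => m; rewrite !ffunE cM //; last exact: MK (fsvalP m).
by apply: ux; apply: fsvalP.
Qed.

Lemma eq_model u u' w :
  {in M, forall m, u' (act w m) = u (act w m)} -> model u' w = model u w.
Proof.
move=> uu'; congr (rule w _); apply/ffunP => m.
by rewrite !ffunE uu' // fsvalP.
Qed.

(** Two charts that meet see each other's centres; this is the only way in
    which distinct charts are compared. *)
Lemma chart_meet c w d m :
  chart act K c -> chart act K w -> d \in K -> m \in K -> m^-1 \in K ->
  act w m = act c d -> w = act c (d * m^-1).
Proof.
move=> [_ cM _] [w1 wM _] dK mK mVK wmcd.
by rewrite -cM // -wmcd wM // mulgV w1.
Qed.

(** A change of [u] inside the copy of [D] at [c] is felt only at the points
    [act c h] with [h] in [D M^-1], hence can be studied in the chart at [c]. *)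
Lemma model_near u u' c w D :
  chart act K c -> chart act K w -> (M `<=` K)%fset -> (invfs M `<=` K)%fset ->
  (D `<=` K)%fset ->
  (forall v, {in D, forall d, act c d != v} -> u' v = u v) ->
  model u' w = model u w \/
  exists2 h, h \in mulfs D (invfs M) & w = act c h.
Proof.
move=> cK wK /fsubsetP MK /fsubsetP MVK /fsubsetP DK u'u.
have [[m mM [d dD wmcd]]|nomeet] := pselect
    (exists2 m, m \in M & exists2 d, d \in D & act w m = act c d).
  right; exists (d * m^-1); first by rewrite mem_mulfs ?mem_invfs ?invgK.
  by apply: chart_meet wmcd; rewrite ?(DK d) ?(MK m) ?(MVK m^-1) ?mem_invfs ?invgK.
left; apply: eq_model => m mM; apply: u'u => d dD.
by apply/eqP => cdwm; apply: nomeet; exists m => //; exists d.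
Qed.

Variable W : {set V}.
Hypothesis chartW : forall w, w \in W -> chart act K w.
Hypotheses (MK : (M `<=` K)%fset) (MVK : (invfs M `<=` K)%fset).

Section Surjectivity.
Variables (s : G -> local_rule M A) (E : {fset G}).
Let H := (1 |` mulfs E (invfs M))%fset.
Hypotheses (EK : (E `<=` K)%fset) (HK : (H `<=` K)%fset).
Hypothesis HMK : (mulfs H M `<=` K)%fset.
Hypothesis post_s : uniformly_post_surjective s E.
Hypothesis local_s : forall w, w \in W ->
  exists2 p, orbit_closure s p & {in H, forall h, rule (act w h) = p h}.

(** In the chart at [w], [rule] coincides with some [p] in the orbit closure
    wherever a change inside [E] can be felt, so that the correction given by
    uniform post-surjectivity can be implanted at [w]. *)
Lemma model_correct_at u w a :
  w \in W -> exists u', model u' w = a /\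
    {in W, forall w', w' != w -> model u' w' = model u w'}.
Proof.
move=> wW; have [p sp rp] := local_s wW; have cw := chartW wW.
have [z [zE za zx]] := post_s sp (act w \; u) a.
exists (implant u w E z).
have near h : h \in H -> model (implant u w E z) (act w h) = nuca p z h /\
    model u (act w h) = nuca p (act w \; u) h.
  move=> hH; have hK := fsubsetP HK h hH.
  split; last exact: (model_chart cw hK MK (rp h hH)).
  apply: (model_chart cw hK MK (rp h hH)) => m mM.
  apply: implant_in => // [|hmE]; last by rewrite zE.
  by apply: (fsubsetP HMK); apply: mem_mulfs.
have H1 : 1 \in H by exact: fset1U1.
have w1 : act w 1 = w by case: cw.
split; first by have [] := near 1 H1; rewrite w1 za.
move=> w' w'W w'w.
have [//|[h hEM w'h]] := model_near cw (chartW w'W) MK MVK EK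
  (fun v => @implant_out u w E z v).
have [|uh' uh] := near h; first by rewrite inE hEM orbT.
rewrite w'h uh uh' zx //; apply: contra w'w => /eqP h1.
by rewrite w'h h1 w1.
Qed.

Lemma model_surjective (y : {ffun V -> A}) :
  exists u, {in W, forall w, model u w = y w}.
Proof.
suff [u uy] : exists u, {in enum W, forall w, w \in W -> model u w = y w}.
  by exists u => w wW; apply: uy; rewrite ?mem_enum.
elim: (enum W) => [|w r [u uy]]; first by exists y.
have [wW|wW] := boolP (w \in W); last first.
  exists u => w'; rewrite inE => /orP[/eqP->|]; first by rewrite (negPf wW).
  exact: uy.
have [u' [u'w u'u]] := model_correct_at u (y w) wW; exists u' => w'.
rewrite inE; have [-> _ _ //|w'w /= w'r w'W] := eqVneq w' w.
by rewrite u'u // uy.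
Qed.

End Surjectivity.

Section Counting.
Variables (C : {set V}) (D : {fset G}) (x1 : G -> A).
Hypothesis CW : C \subset W.
Hypothesis DK : (D `<=` K)%fset.
Hypothesis packC : forall c c' d d', c \in C -> c' \in C -> d \in D -> d' \in D ->
  act c d = act c' d' -> c = c'.

Definition occurs c u := [forall d : D, u (act c (val d)) == x1 (val d)].
Definition avoiding (r : seq V) := [set u | all (fun c => ~~ occurs c u) r]%SET.

Lemma occursP c u :
  reflect {in D, forall d, u (act c d) = x1 d} (occurs c u).
Proof.
apply: (iffP forallP) => [cu d dD|cu d]; last by rewrite cu ?fsvalP.
by have /eqP := cu [` dD]%fset.
Qed.

Let chartC c : c \in C -> chart act K c.
Proof. by move=> cC; apply: chartW; apply: (fintype.subsetP CW). Qed.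

Lemma implant_other u c c' E z :
  c \in C -> c' \in C -> c != c' -> (E `<=` D)%fset ->
  occurs c' (implant u c E z) = occurs c' u.
Proof.
move=> cC c'C cc' /fsubsetP ED; apply/occursP/occursP => occ d dD; rewrite -?occ //.
  rewrite implant_out // => e eE; apply: contra cc' => /eqP.
  by move/packC => -> //; apply: ED.
rewrite implant_out ?occ // => e eE; apply: contra cc' => /eqP.
by move/packC => -> //; apply: ED.
Qed.

(** Overwriting the copy of [D] at [c] by [x1] loses only the values there.
    Hence the configurations with [x1] at [c] make up a proportion at least
    [#|A| ^ - #|D|] of those that avoid [x1] at the points of [r]; the
    overwriting does not affect the latter condition, since copies are
    disjoint. *)
Lemma card_avoiding_step c r :
  c \in C -> {subset r <= C} -> c \notin r ->
  (#|avoiding (c :: r)| * #|A| ^ #|`D|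
    <= #|avoiding r| * (#|A| ^ #|`D|).-1)%N.
Proof.
move=> cC rC cr; set Y := [set u in avoiding r | occurs c u]%SET.
have -> : #|avoiding (c :: r)| = (#|avoiding r| - #|Y|)%N.
  rewrite -(cardsID [set u | occurs c u] (avoiding r))%SET.
  rewrite (_ : (_ :&: _) = Y)%SET; last by apply/finset.setP => u; rewrite !inE.
  rewrite addKn; apply: eq_card => u; rewrite !inE //=.
have le : (#|avoiding r| <= #|Y| * #|A| ^ #|`D|)%N.
  pose code u := (implant u c D x1, [ffun d : D => u (act c (val d))]).
  have code_inj : injective code.
    move=> u u' [imp]; move/ffunP => res; apply/ffunP => v.
    have [[d dD cd]|nov] := pselect (exists2 d, d \in D & act c d = v).
      by have := res [` dD]%fset; rewrite !ffunE /= cd.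
    have out d : d \in D -> act c d != v.
      by move=> dD; apply/eqP => cd; apply: nov; exists d.
    by rewrite -(@implant_out u c D x1 v) // imp implant_out.
  rewrite -(card_imset (mem (avoiding r)) code_inj).
  apply: (@leq_trans #|finset.setX Y [set: {ffun D -> A}]|%SET).
    apply/subset_leq_card/fintype.subsetP => _ /imsetP[u ur ->].
    rewrite !inE /= andbT; apply/andP; split.
      apply/allP => c' c'r; rewrite implant_other ?cC ?(rC c') //.
        by move: ur; rewrite inE => /allP/(_ c' c'r).
      by apply: contraNneq cr => ->.
    apply/occursP => d dD; apply: implant_in => //; rewrite ?dD //.
      exact: chartC.
    exact: (fsubsetP DK).
  by rewrite cardsX cardsT card_ffun cardfE.
rewrite mulnBl -subn1 mulnBr muln1.
exact: leq_sub2l.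
Qed.

Lemma card_avoiding :
  (#|avoiding (enum C)| * #|A| ^ (#|`D| * #|C|)
    <= #|A| ^ #|V| * (#|A| ^ #|`D|).-1 ^ #|C|)%N.
Proof.
have rC : {subset enum C <= C} by move=> c; rewrite mem_enum.
rewrite [#|C|]cardE; move: (enum_uniq C) rC; elim: (enum C) => [|c r IH] /=.
  by move=> _ _; rewrite !muln0 !expn0 !muln1 -card_ffun max_card.
move=> /andP[cr ur] rC; rewrite mulnS expnD expnSr mulnA.
apply: (@leq_trans (#|avoiding r| * (#|A| ^ #|`D|).-1 * #|A| ^ (#|`D| * size r))).
  rewrite leq_mul2r card_avoiding_step ?orbT // ?rC ?mem_head // => c' c'r.
  by rewrite rC // inE c'r orbT.
rewrite mulnAC !mulnA leq_mul2r; apply/orP; right.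
by apply: IH => // c' c'r; rewrite rC // inE c'r orbT.
Qed.

Section Replace.
Variables (s : G -> local_rule M A) (x2 : G -> A) (E : {fset G}).
Hypotheses (ED : (E `<=` D)%fset)
  (EMMD : (mulfs (mulfs E (invfs M)) M `<=` D)%fset)
  (EMK : (mulfs E (invfs M) `<=` K)%fset).
Hypothesis x12 : forall g, g \notin E -> x1 g = x2 g.
Hypothesis nuca12 : nuca s x1 = nuca s x2.
Hypothesis x1x2 : x1 <> x2.
Hypothesis rule_s : {in C, forall c,
  {in mulfs E (invfs M), forall h, rule (act c h) = s h}}.

(** [x1] and [x2] are exchangeable: [D] is so large that an occurrence of [x1]
    on [D] fixes the image at each point that feels a change inside [E]. *)
Lemma model_implant u c w :
  c \in C -> w \in W -> occurs c u -> model (implant u c E x2) w = model u w.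
Proof.
move=> cC wW /occursP occ.
have [//|[h hEM ->]] := model_near (chartC cC) (chartW wW) MK MVK
   (fsubset_trans ED DK) (fun v => @implant_out u c E x2 v).
have hK : h \in K by apply: (fsubsetP EMK).
have near m : m \in M -> h * m \in D.
  by move=> mM; apply: (fsubsetP EMMD); apply: mem_mulfs.
rewrite (model_chart (p := s) (x := x2) (chartC cC)) ?rule_s // -?nuca12.
  by rewrite (model_chart (p := s) (x := x1) (chartC cC)) ?rule_s // => m /near/occ.
move=> m /near hmD; apply: implant_in (chartC cC) (fsubset_trans ED DK) _ _.
  exact: (fsubsetP DK).
by move=> hmE; rewrite occ // x12.
Qed.

Lemma avoiding_model u :
  exists2 u', u' \in avoiding (enum C) & {in W, forall w, model u' w = model u w}.
Proof.
have rC : {subset enum C <= C} by move=> c; rewrite mem_enum.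
elim: (enum C) rC => [|c r IH] rC; first by exists u; rewrite ?inE.
have [|u1 u1r u1u] := IH; first by move=> c' c'r; rewrite rC // inE c'r orbT.
have [occ|nocc] := boolP (occurs c u1); last first.
  by exists u1 => //; rewrite inE /= nocc; move: u1r; rewrite inE.
have cC : c \in C by rewrite rC ?mem_head.
have nocc2 : ~~ occurs c (implant u1 c E x2).
  apply/occursP => occ2; apply: x1x2; apply/funext => g.
  have [gE|] := boolP (g \in E); last exact: x12.
  have gD := fsubsetP ED g gE; rewrite -occ2 //.
  apply: implant_in (chartC cC) (fsubset_trans ED DK) (fsubsetP DK g gD) _.
  by rewrite gE.
exists (implant u1 c E x2); last by move=> w wW; rewrite model_implant // u1u.
rewrite inE /= nocc2 /=; apply/allP => c' c'r.
have [-> //|cc'] := eqVneq c' c.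
rewrite implant_other // 1?eq_sym //; last by rewrite rC // inE c'r orbT.
by move: u1r; rewrite inE => /allP/(_ c' c'r).
Qed.

End Replace.

End Counting.

(** The values of [y] on [W] are recovered from a preimage in [S], and the
    others are recorded separately. *)
Lemma card_surjective_model (S : {set {ffun V -> A}}) :
  (forall y : {ffun V -> A}, exists2 u, u \in S & {in W, forall w, model u w = y w}) ->
  (#|A| ^ #|V| <= #|S| * #|A| ^ #|~: W|%SET)%N.
Proof.
move=> surj; have /choice [pre preP] : forall y : {ffun V -> A}, exists u,
    u \in S /\ {in W, forall w, model u w = y w}.
  by move=> y; have [u uS uy] := surj y; exists u.
pose Wc := {v | v \in ~: W}%SET.
pose code y := (pre y, [ffun v : Wc => y (val v)]).
have code_inj : injective code.
  move=> y y' [eqpre]; move/ffunP => res; apply/ffunP => v.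
  have [vW|vW] := boolP (v \in W).
    by rewrite -(preP y).2 // -(preP y').2 // eqpre.
  have vWc : v \in (~: W)%SET by rewrite inE.
  by have := res (exist _ v vWc); rewrite !ffunE.
rewrite -card_ffun -(card_codom code_inj).
apply: (@leq_trans #|finset.setX S [set: {ffun Wc -> A}]|%SET).
  apply/subset_leq_card/fintype.subsetP => _ /codomP[y ->].
  by rewrite !inE (preP y).1.
by rewrite cardsX cardsT card_ffun card_sig.
Qed.

End FiniteModel.

(** * Packing and counting *)

(** Take a family of centres that is maximal for disjointness of the copies of
    [L]. *)
Lemma ex_packing (G : groupType) (V : finType) (act : V -> G -> V)
    (L : {fset G}) (W : {set V}) :
  1 \in L ->
  exists C : {set V},
    [/\ C \subset W,
        forall c c' l l', c \in C -> c' \in C -> l \in L -> l' \in L ->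
          act c l = act c' l' -> c = c'
      & {in W, forall w, exists c l l',
          [/\ c \in C, l \in L, l' \in L & act w l = act c l']}].
Proof.
move=> L1; pose packed (C : {set V}) := `[< C \subset W /\
  forall c c' l l', c \in C -> c' \in C -> l \in L -> l' \in L ->
          act c l = act c' l' -> c = c' >].
have [|C /maxsetP [/asboolP[CW pC] maxC]] := @ex_maxset _ packed.
  exists finset.set0; apply/asboolP; split; first exact: finset.sub0set.
  by move=> c c' l l'; rewrite inE.
exists C; split=> // w wW; apply: contrapT => nomeet.
have sep c l l' : c \in C -> l \in L -> l' \in L -> act w l <> act c l'.
  by move=> cC lL l'L meet; apply: nomeet; exists c, l, l'.
have wC : w \notin C by apply/negP => wC; exact: (sep w 1 1).
have wCC : (w |: C)%SET = C.
  apply: maxC; last exact: finset.subsetUr.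
  apply/asboolP; split; first by rewrite finset.subUset finset.sub1set wW.
  move=> c c' l l'; rewrite !inE => /orP[/eqP->|cC] /orP[/eqP->|c'C] lL l'L //.
  - by move/(sep _ _ _ c'C lL l'L).
  - by move/esym/(sep _ _ _ cC l'L lL).
  - exact: pC.
by move: wC; rewrite -wCC !inE eqxx.
Qed.

(** Bernoulli's inequality, in the form [Q^(k+1) + (k+1) Q^k <= (Q+1)^(k+1)],
    with [k = a Q]; the gap occurs at the exponent [k+1]. *)
Lemma exponential_gap (a Q : nat) : exists2 k, (0 < k)%N & (a * Q ^ k < Q.+1 ^ k)%N.
Proof.
exists (a * Q).+1 => //.
have bern k : (Q ^ k.+1 + k.+1 * Q ^ k <= Q.+1 ^ k.+1)%N.
  elim: k => [|k IH]; first by rewrite !expn1 expn0 muln1 addn1.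
  rewrite [X in (_ <= X)%N]expnS; apply: leq_trans (leq_mul (leqnn _) IH).
  rewrite !expnS; nia.
have [->|Q0] := posnP Q; first by rewrite exp0n ?muln0 ?expn_gt0.
apply: leq_trans (bern _); rewrite expnS mulnA mulSn addnCA -add1n.
by rewrite leq_add ?expn_gt0 ?Q0 ?leq_addl.
Qed.

(** [n] points of which [b] are bad, and [c] centres, each accounting for at
    most [l] good points; [B] is the number of patterns at a centre, one of
    which is dispensable, and [a] the size of the alphabet.  There are at least
    [k] centres for each bad point, and the losses at [k] centres outweigh the
    freedom [a] at one bad point. *)
Lemma packing_excludes_surjection (a B b c n l k : nat) :
  (0 < B)%N -> (0 < l)%N -> (0 < n)%N -> (0 < k)%N ->
  (a * B.-1 ^ k < B ^ k)%N ->
  (b * (k * l).+1 <= n)%N -> (n <= c * l + b)%N ->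
  (B ^ c <= B.-1 ^ c * a ^ b)%N -> False.
Proof.
move=> B0 l0 n0 k0 gap bn nc.
have kbc : (k * b <= c)%N.
  rewrite -(leq_pmul2r l0) -(leq_add2r b); apply: leq_trans nc.
  apply: leq_trans bn.
  by rewrite mulnS addnC mulnAC [(k * l * b)%N]mulnC.
have c0 : (0 < c)%N.
  case: c nc kbc => // nc; rewrite leqn0 muln_eq0 => /orP[/eqP k00|/eqP b0].
    by rewrite k00 in k0.
  by move: nc; rewrite b0 mul0n addn0 leqn0 => /eqP n00; rewrite n00 in n0.
rewrite leqNgt => /negP; apply.
rewrite -(subnK kbc) !expnD -mulnA [(_ * a ^ b)%N]mulnC !expnM -expnMn.
have [b0|b0] := posnP b.
  rewrite b0 !expn0 !muln1 muln0 subn0 ltn_exp2r ?ltn_predL //.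
apply: (@leq_ltn_trans (B ^ (c - k * b) * (a * B.-1 ^ k) ^ b)%N).
  rewrite leq_mul2r; apply/orP; right.
  by case: (c - k * b)%N => // e; rewrite leq_exp2r ?leq_pred.
by rewrite ltn_pmul2l ?expn_gt0 ?B0 // ltn_exp2r.
Qed.

(** * Pre-injectivity *)

(** [D0] carries the difference of [x1] and [x2], and [D] its surroundings that
    determine the images near [D0].  [H] is the set of positions, relative to
    a good point, where a correction at that point can be felt.  [E] makes the
    collar thick enough for a translate of [H] that meets [F] to stay in
    [L = F E], where the finite model copies [s] exactly; it also puts [D]
    inside [F].  All products of at most three elements that occur in the
    comparison of charts lie in [K]. *)
Lemma sofic_pre_injective (R : realType) (G : groupType) (A : finType)
    (M : {fset G}) (s : G -> local_rule M A) (E0 : {fset G}) :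
  finitely_generated G -> sofic R G -> uniformly_bounded_singularity s ->
  uniformly_post_surjective s E0 -> pre_injective s.
Proof.
move=> fgG soficG ubs post x1 x2 [D0 x12] nuca12; apply: contrapT => x1x2.
pose H := (1 |` mulfs E0 (invfs M))%fset.
pose D := (D0 `|` mulfs (mulfs D0 (invfs M)) M)%fset.
pose E := (1 |` mulfs (invfs H) H `|` mulfs D0 (invfs M) `|` D)%fset.
have [F [c0 [/fsubsetP EF collar flat]]] := constant_collar E H fgG ubs.
pose L := mulfs F E.
have E1 : 1 \in E by rewrite !in_fsetU fset11.
have FL f : f \in F -> f \in L.
  by move=> fF; apply/mulfsP; exists f => //; exists 1; rewrite ?mulg1.
have DL d : d \in D -> d \in L by move=> dD; rewrite FL ?EF // in_fsetU dD orbT.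
have D0ML d : d \in mulfs D0 (invfs M) -> d \in L.
  by move=> dD; rewrite FL ?EF // !in_fsetU dD !orbT.
have L1 : 1 \in L by rewrite FL ?EF.
(* [K0] collects the factors of the products that the charts must respect. *)
pose K0 := (M `|` invfs M `|` E0 `|` H `|` invfs H `|` L `|` invfs L)%fset.
have inK0 g : [|| g \in M, g \in invfs M, g \in E0, g \in H, g \in invfs H,
    g \in L | g \in invfs L] -> g \in K0.
  by rewrite !in_fsetU -!orbA.
have K01 : 1 \in K0 by rewrite inK0 // L1 !orbT.
pose K := mulfs (mulfs K0 K0) K0.
have K3 a b c : a \in K0 -> b \in K0 -> c \in K0 -> a * b * c \in K.
  by move=> aK bK cK; rewrite !mem_mulfs.
have K2 a b : a \in K0 -> b \in K0 -> a * b \in K.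
  by move=> aK bK; rewrite -(mulg1 (a * b)) K3.
have K1 a : a \in K0 -> a \in K by move=> aK; rewrite -(mulg1 a) K2.
have MK : (M `<=` K)%fset by apply/fsubsetP => g gM; rewrite K1 ?inK0 ?gM.
have MVK : (invfs M `<=` K)%fset.
  by apply/fsubsetP => g gM; rewrite K1 ?inK0 ?gM ?orbT.
have E0K : (E0 `<=` K)%fset.
  by apply/fsubsetP => g gE; rewrite K1 ?inK0 ?gE ?orbT.
have HK : (H `<=` K)%fset by apply/fsubsetP => g gH; rewrite K1 ?inK0 ?gH ?orbT.
have HMK : (mulfs H M `<=` K)%fset.
  apply/fsubsetP => _ /mulfsP[h hH [m mM ->]].
  by rewrite K2 ?inK0 ?hH ?mM ?orbT.
have LK l : l \in L -> l \in K by move=> lL; rewrite K1 ?inK0 ?lL ?orbT.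
have DK : (D `<=` K)%fset by apply/fsubsetP => d /DL/LK.
have D0MK : (mulfs D0 (invfs M) `<=` K)%fset by apply/fsubsetP => d /D0ML/LK.
(* The numbers are chosen in this order: the gap [k] depends on the pattern
   only, [l] on the packed set, and the proportion of bad points on both. *)
pose a := #|A|; pose B := (a ^ #|`D|)%N.
have a_gt0 : (0 < a)%N by apply/card_gt0P; exists (x1 1).
have B_gt0 : (0 < B)%N by rewrite expn_gt0 a_gt0.
have [k k_gt0 gap] := exponential_gap a B.-1; rewrite prednK // in gap.
pose l := (#|`L| * #|`L|)%N.
have l_gt0 : (0 < l)%N.
  by rewrite muln_gt0 andbb cardfs_gt0; apply/fset0Pn; exists 1.
have [n [act [W [n_gt0 badW chartW]]]] := sofic_charts K (k * l).+1 soficG.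
have [C [CW packC coverC]] := ex_packing act W L1.
have chartC c : c \in C -> chart act K c by move=> cC; apply/chartW/(fintype.subsetP CW).
have cover w : w \in W -> exists c l l',
    [/\ c \in C, l \in L, l' \in L & w = act c (l' * l^-1)].
  move=> wW; have [c [l1 [l2 [cC l1L l2L meet]]]] := coverC w wW.
  exists c, l1, l2; split=> //.
  apply: (chart_meet (chartC c cC) (chartW w wW) (LK _ l2L) (LK _ l1L)) meet.
  have l1V : l1^-1 \in invfs L by rewrite mem_invfs invgK.
  by rewrite K1 ?inK0 ?l1V ?orbT.
pose rule v : local_rule M A :=
  if [pick f : F | [exists c in C, act c (val f) == v]] is Some f
  then s (val f) else c0.
have ruleL c e : c \in C -> e \in L -> rule (act c e) = s e.
  move=> cC eL; rewrite /rule; case: pickP => [f /exists_inP[c' c'C /eqP ce]|none].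
    have fL := FL _ (fsvalP f).
    have [_ _ cI] := chartC c cC.
    have cc' := packC _ _ _ _ c'C cC fL eL ce; rewrite cc' in ce.
    by congr (s _); apply: cI (LK _ fL) (LK _ eL) ce.
  have eF : e \notin F.
    apply/negP => eF; have /negbT/exists_inP := none [` eF]%fset.
    by apply; exists c.
  by rewrite (collar e eL eF).
have local w : w \in W ->
    exists2 p, orbit_closure s p & {in H, forall h, rule (act w h) = p h}.
  move=> wW; have [w1 wM _] := chartW w wW.
  have [[h0 [c [f [h0H cC fF meet]]]]|nomeet] := pselect (exists h0 c f,
      [/\ h0 \in H, c \in C, f \in F & act w h0 = act c f]).
    exists (shift (f * h0^-1)^-1 s).
      exact/orbit_closure_shift/orbit_closure_self.
    have h0V : h0^-1 \in K0.
      have h0VH : h0^-1 \in invfs H by rewrite mem_invfs invgK.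
      by rewrite inK0 // h0VH !orbT.
    have h0K : h0 \in K by apply: (fsubsetP HK).
    have fK0 : f \in K0 by rewrite inK0 // FL // !orbT.
    have -> := chart_meet (chartC c cC) (chartW w wW) (K1 _ fK0) h0K (K1 _ h0V) meet.
    have [_ cM _] := chartC c cC.
    move=> h hH; have hK : h \in K by apply: (fsubsetP HK).
    rewrite cM ?K2 // ruleL //; first by rewrite /shift invgK.
    rewrite -mulgA mem_mulfs // !in_fsetU [_ * h \in mulfs _ _]mem_mulfs ?orbT //.
    by rewrite mem_invfs invgK.
  (* No copy of [F] is seen from [w]: [rule] is equal to [c0] around [w]. *)
  case: flat => [[g gc0]|allF].
    exists (shift g^-1 s); first exact/orbit_closure_shift/orbit_closure_self.
    move=> h hH; rewrite /shift invgK gc0 // /rule.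
    case: pickP => // f /exists_inP[c cC /eqP cf]; case: nomeet.
    by exists h, c, (val f); split=> //; apply: fsvalP.
  (* Here [F] is all of [G], and [w] itself lies in a copy of [F]. *)
  have [c [l1 [l2 [cC l1L l2L wE]]]] := cover w wW; case: nomeet.
  by exists 1, c, (l2 * l1^-1); rewrite w1 fset1U1 allF.
have cardC : (n <= #|C| * l + #|~: W|%SET)%N.
  rewrite -[X in (X <= _)%N](card_ord n) -(cardsC W) leq_add2r.
  pose pt (t : 'I_n * (L * L)) := act t.1 (val t.2.2 * (val t.2.1)^-1).
  have -> : l = #|{: L * L}| by rewrite card_prod -!cardfE.
  rewrite -[#|{: L * L}|]cardsT -cardsX.
  apply: leq_trans (leq_imset_card pt _).
  apply/subset_leq_card/fintype.subsetP => w /cover[c [l1 [l2 [cC l1L l2L ->]]]].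
  by apply/imsetP; exists (c, ([` l1L], [` l2L])%fset); rewrite // !inE cC.
apply: (packing_excludes_surjection B_gt0 l_gt0 n_gt0 k_gt0 gap badW cardC).
have packD c c' d d' : c \in C -> c' \in C -> d \in D -> d' \in D ->
    act c d = act c' d' -> c = c'.
  by move=> cC c'C /DL dL /DL d'L; apply: packC.
have avoidS := card_avoiding chartW x1 CW DK packD.
have surj : (a ^ #|'I_n| <=
    #|avoiding act D x1 (enum C)| * a ^ #|~: W|%SET)%N.
  apply: (card_surjective_model (rule := rule) (act := act)) => y.
  have [u uy] := model_surjective chartW MK MVK E0K HK HMK post local y.
  have [|||u' u'S u'u] := avoiding_model (E := D0) (rule := rule) (x1 := x1)
     chartW MK MVK CW DK packD _ _ D0MK x12 nuca12 x1x2 _ u.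
  - exact: fsubsetUl.
  - exact: fsubsetUr.
  - by move=> c cC h /D0ML; apply: ruleL.
  by exists u' => // w wW; rewrite u'u // uy.
rewrite -(@leq_pmul2l (a ^ #|'I_n|)) ?expn_gt0 ?a_gt0 // mulnA.
apply: leq_trans (leq_mul avoidS (leqnn _)).
rewrite -expnM mulnAC; exact: leq_mul.
Qed.

(** * The inverse automaton *)

Section Inverse.
Variables (G : groupType) (M : {fset G}) (A : finType).
Implicit Types (s p : G -> local_rule M A) (x y z : G -> A) (E N : {fset G}).

(** A failure of pre-injectivity involves [p] at finitely many cells only, and
    there [p] is a translate of [s]. *)
Lemma pre_injective_orbit_closure s p :
  pre_injective s -> orbit_closure s p -> pre_injective p.
Proof.
move=> inj /orbit_closureP sp x1 x2 [E x12] p12.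
have [g gK] := sp (mulfs E (invfs M)).
have shift12 h : nuca (shift g s) x1 h = nuca (shift g s) x2 h.
  have [hK|hK] := boolP (h \in mulfs E (invfs M)).
    transitivity (nuca p x1 h); first by apply: eq_nuca; rewrite ?gK.
    by rewrite p12; apply: eq_nuca; rewrite ?gK.
  apply: eq_nuca => // m mM; apply: x12; apply: contra hK => hmE.
  by apply/mulfsP; exists (h * m) => //; exists m^-1; rewrite ?mem_invfs ?invgK ?mulgK.
suff : shift g^-1 x1 = shift g^-1 x2 by move/(congr1 (shift g)); rewrite !shiftK.
apply: inj.
  exists (mulfs [fset g^-1]%fset E) => h hE; apply: x12; apply: contra hE.
  by rewrite invgK => ghE; rewrite -(mulKg g h) mem_mulfs ?inE.
apply/funext => h; rewrite -(mulKg g h) -!nuca_shift !shiftK.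
exact: shift12.
Qed.

Lemma post_surjective_at s E p x g a :
  uniformly_post_surjective s E -> orbit_closure s p ->
  exists z, [/\ forall h, g^-1 * h \notin E -> z h = x h, nuca p z g = a
    & forall h, h != g -> nuca p z h = nuca p x h].
Proof.
move=> post sp.
have [z [zx za zE]] := post _ (orbit_closure_shift (g := g^-1) sp) (shift g^-1 x) a.
have move_p y h : nuca p (shift g y) h = nuca (shift g^-1 p) y (g^-1 * h).
  by rewrite -nuca_shift shiftK.
exists (shift g z); split.
- by move=> h hE; rewrite /shift zx // /shift invgK mulKVg.
- by rewrite move_p mulVg.
move=> h hg; rewrite move_p zE.
  by rewrite -move_p shiftK.
by apply: contra hg => /eqP gh; rewrite -(mulKVg g h) gh mulg1.
Qed.

(** Correct the image of [x] into that of [x'] one cell at a time; by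
    pre-injectivity the process ends at [x'].  A cell where the images already
    agree needs no correction, and a correction at any other cell does not
    touch [h]. *)
Lemma asymptotic_determined s E p x x' h :
  uniformly_post_surjective s E -> orbit_closure s p -> pre_injective p ->
  asymptotic x x' ->
  {in E, forall e, nuca p x (h * e^-1) = nuca p x' (h * e^-1)} -> x h = x' h.
Proof.
move=> post sp inj xx'.
have [r rP] : exists r : seq G, forall g, g \notin r -> nuca p x g = nuca p x' g.
  have [D xD] := xx'; exists (mulfs D (invfs M)) => g gD.
  apply: eq_nuca => // m mM; apply: xD; apply: contra gD => gmD.
  by apply/mulfsP; exists (g * m) => //; exists m^-1; rewrite ?mem_invfs ?invgK ?mulgK.
elim: r x xx' rP => [|g r IH] x xx' rP win.
  by rewrite (inj x x' xx') //; apply/funext => g; apply: rP.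
have [eqg|neqg] := eqVneq (nuca p x g) (nuca p x' g).
  apply: IH => // k kr; have [->//|kg] := eqVneq k g.
  by apply: rP; rewrite inE negb_or kg.
have [z [zx zg zE]] := post_surjective_at x g (nuca p x' g) post sp.
rewrite -zx; last first.
  apply: contra neqg => ghE; apply/eqP; have := win _ ghE.
  by rewrite invgM invgK mulKVg.
apply: IH.
- have [D xD] := xx'; exists (D `|` mulfs [fset g]%fset E)%fset => k.
  rewrite inE negb_or => /andP[kD kE]; rewrite zx ?xD //.
  by apply: contra kE => gkE; rewrite -(mulKVg g k) mem_mulfs ?inE.
- move=> k kr; have [->//|kg] := eqVneq k g.
  by rewrite zE //; apply: rP; rewrite inE negb_or kg.
by move=> e eE; have [->//|kg] := eqVneq (h * e^-1) g; rewrite zE ?win.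
Qed.

(** Only the values of [x'] near [h] matter, so that [x'] may be replaced by a
    configuration that is asymptotic to [x]. *)
Lemma locally_determined s E p x x' h :
  uniformly_post_surjective s E -> orbit_closure s p -> pre_injective p ->
  {in E, forall e, nuca p x (h * e^-1) = nuca p x' (h * e^-1)} -> x h = x' h.
Proof.
move=> post sp inj win.
pose K := (h |` mulfs (mulfs [fset h]%fset (invfs E)) M)%fset.
pose x'' g := if g \in K then x' g else x g.
have -> : x' h = x'' h by rewrite /x'' fset1U1.
apply: (asymptotic_determined post sp inj).
  by exists K => g gK; rewrite /x'' ifN.
move=> e eE; rewrite win //; apply: eq_nuca => // m mM; rewrite /x'' ifT //.
by rewrite inE; apply/orP; right; rewrite !mem_mulfs ?inE ?mem_invfs ?invgK.
Qed.

Section InverseRule.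
Variables (N : {fset G}) (N1 : 1 \in N).

Definition solves p g (u : {ffun N -> A}) a :=
  exists2 z, forall n : N, nuca p z (g * val n) = u n & z g = a.

(** The value [u 1] in the absence of a solution is arbitrary; it is the reason
    for [1 \in N], and it avoids a separate treatment of an empty alphabet. *)
Definition inverse_rule p : G -> local_rule N A := fun g =>
  [ffun u => if [pick a | `[< solves p g u a >]] is Some a then a
             else u [` N1]%fset].

Lemma eq_inverse_rule p p' g g' :
  (forall u a, solves p g u a <-> solves p' g' u a) ->
  inverse_rule p g = inverse_rule p' g'.
Proof.
move=> pp'; apply/ffunP => u; rewrite !ffunE.
by under eq_pick => a do rewrite (propext (pp' u a)).
Qed.

Lemma inverse_rule_local p p' g :
  {in N, forall n, p (g * n) = p' (g * n)} ->
  inverse_rule p g = inverse_rule p' g.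
Proof.
move=> pp'; have nucan z (n : N) : nuca p z (g * val n) = nuca p' z (g * val n).
  by apply: eq_nuca => //; apply: pp'; apply: fsvalP.
apply: eq_inverse_rule => u a.
by split=> -[z zu za]; exists z => // n; rewrite -zu nucan.
Qed.

Lemma inverse_rule_shift p g h :
  inverse_rule (shift h p) g = inverse_rule p (h^-1 * g).
Proof.
apply: eq_inverse_rule => u a; split=> -[z zu za].
  exists (shift h^-1 z) => [n|]; last by rewrite /shift invgK mulKVg.
  by rewrite -zu -{2}(shiftK h z) nuca_shift mulgA.
exists (shift h z) => [n|]; last exact: za.
by rewrite -zu nuca_shift mulgA.
Qed.

Lemma orbit_closure_inverse_rule s p :
  orbit_closure s p -> orbit_closure (inverse_rule s) (inverse_rule p).
Proof.
move/orbit_closureP => sp; apply/orbit_closureP => K.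
have [g gK] := sp (mulfs K N); exists g => k kK.
rewrite {1}/shift -inverse_rule_shift; apply: inverse_rule_local => n nN.
by rewrite gK ?mem_mulfs.
Qed.

Lemma inverse_ruleK p :
  (forall x x' g,
    {in N, forall n, nuca p x (g * n) = nuca p x' (g * n)} -> x g = x' g) ->
  cancel (nuca p) (nuca (inverse_rule p)).
Proof.
move=> det x; apply/funext => g; rewrite nucaE ffunE.
case: pickP => [a /asboolP[z zx <-]|none].
  apply: det => n nN; have := zx [` nN]%fset.
  by rewrite ffunE.
have /negP := negbT (none (x g)); case; apply/asboolP.
by exists x => // n; rewrite ffunE.
Qed.

End InverseRule.

(** [nuca p \o nuca q] fixes every image under [nuca p].  At a given cell, [y]
    may be replaced by a configuration that is asymptotic to an image, hence is
    itself an image by post-surjectivity. *)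
Lemma post_surjective_right_inverse N p (q : G -> local_rule N A) :
  post_surjective p -> cancel (nuca p) (nuca q) -> cancel (nuca q) (nuca p).
Proof.
move=> post qp y; apply/funext => g.
pose K := (g |` mulfs (mulfs [fset g]%fset M) N)%fset.
pose y' h := if h \in K then y h else nuca p y h.
have [|z _ pz] := post y y'; first by exists K => h hK; rewrite /y' ifN.
transitivity (y' g); last by rewrite /y' fset1U1.
rewrite -pz -(qp z); apply: eq_nuca => // m mM.
rewrite pz; apply: eq_nuca => // n nN; rewrite /y' ifT //.
by rewrite inE; apply/orP; right; rewrite !mem_mulfs ?inE.
Qed.

End Inverse.

Theorem theoremD (R : realType) (G : groupType) (A : finType) (M : {fset G})
    (s : G -> local_rule M A) :
  finitely_generated G -> sofic R G ->
  uniformly_bounded_singularity s ->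
  stably_post_surjective s ->
  stably_invertible s.
Proof.
move=> fgG soficG ubs post; have [E unif] := stably_post_surjective_uniform post.
have inj : pre_injective s := sofic_pre_injective fgG soficG ubs unif.
pose N := (1 |` invfs E)%fset; have N1 : 1 \in N := fset1U1 1 _.
exists N, (inverse_rule N1 s) => p sp.
exists (inverse_rule N1 p); first exact: orbit_closure_inverse_rule.
have leftK : cancel (nuca p) (nuca (inverse_rule N1 p)).
  apply: inverse_ruleK => x x' g win.
  apply: (locally_determined unif sp (pre_injective_orbit_closure inj sp)).
  by move=> e eE; apply: win; rewrite inE mem_invfs invgK eE orbT.
split; apply/funext => x /=; last exact: leftK.
exact: (post_surjective_right_inverse (post p sp) leftK).
Qed.
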